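(* Let $\mathcal{F}$ be a non-exceptional family of complex polynomials such that every pair of elements of $\mathcal{F}$ shares a common iterate: for all $P,Q\in\mathcal{F}$ there are integers $m,n\ge1$ with $P^m=Q^n$. Then the semigroup $S(\mathcal{F})$ generated by $\mathcal{F}$ under composition is amenable and $RIM(S(\mathcal{F}))\subset LIM(S(\mathcal{F}))$.
   Context: Powers denote iterates. $S(\mathcal{F})$ consists of all finite non-empty compositions of elements of $\mathcal{F}$. A polynomial is exceptional if it has degree $1$ or is affinely conjugate to $z^n$ or to $\pm$ a Chebyshev polynomial. A family of polynomials is non-exceptional if it contains at least one non-exceptional polynomial. For a semigroup $S$, let $L_\infty(S)$ be the Banach space of bounded complex functions on $S$ with sup norm; a mean is a continuous linear functional $M$ with $M(\phi)\ge0$ for $\phi\ge0$ and $\|M\|=M(\chi_S)=1$. Put $r_s(\phi)(x)=\phi(xs)$, $l_s(\phi)(x)=\phi(sx)$. $RIM(S)$ (resp. $LIM(S)$) is the set of means $M$ with $M(r_s\phi)=M(\phi)$ (resp. $M(l_s\phi)=M(\phi)$) for all $s\in S$, $\phi\in L_\infty(S)$. $S$ is amenable if $RIM(S)\cap LIM(S)\ne\emptyset$. *)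

(* Defs.v *)
(* MathComp-Analysis development; the complex field is [R[i]] for [R : realType]. *)
From HB Require Import structures.
From mathcomp Require Import all_boot all_order all_algebra.
From mathcomp Require Import all_classical all_reals all_analysis.
From mathcomp Require Import complex ring.

Set Implicit Arguments.
Unset Strict Implicit.
Unset Printing Implicit Defensive.

Import Order.TTheory GRing.Theory Num.Theory.
Import numFieldNormedType.Exports.

Local Open Scope classical_set_scope.
Local Open Scope complex_scope.
Local Open Scope ring_scope.

Section Polynomials.
Variable K : fieldType.
Implicit Types (P Q : {poly K}) (F : set {poly K}).

(* [P^n] in the sense of composition *)
Definition poly_iter (n : nat) P : {poly K} := iter n (fun Q => P \Po Q) 'X.

(* [P = L^-1 o Q o L] with [L = a z + b], so [L^-1 = a^-1 (z - b)] *)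
Definition affine_conjugate P Q : Prop :=
  exists a b : K, a != 0 /\
    P = (a^-1 *: ('X - b%:P)) \Po (Q \Po (a *: 'X + b%:P)).

Fixpoint chebyshev (n : nat) : {poly K} :=
  match n with
  | 0 => 1
  | 1 => 'X
  | (m.+1 as k).+1 => 'X * chebyshev k *+ 2 - chebyshev m
  end.

(* [size P = 2] means degree 1; [n = 1] below only gives degree 1 again *)
Definition exceptional P : Prop :=
  size P = 2
  \/ exists2 n, (0 < n)%N &
     [\/ affine_conjugate P 'X^n,
         affine_conjugate P (chebyshev n)
       | affine_conjugate P (- chebyshev n)].

Definition nonexceptional_family F : Prop := exists2 P, F P & ~ exceptional P.

Definition share_iterate P Q : Prop :=
  exists m n, [/\ (0 < m)%N, (0 < n)%N & poly_iter m P = poly_iter n Q].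

Definition compositions F : set {poly K} :=
  [set P | exists s : seq {poly K},
    [/\ s != [::], (forall Q, Q \in s -> F Q) &
        P = foldr (fun A B => A \Po B) 'X s]].

Lemma compositions_comp F P Q :
  compositions F P -> compositions F Q -> compositions F (P \Po Q).
Proof.
move=> [s [s0 Fs ->]] [t [t0 Ft ->]]; exists (s ++ t); split.
- by case: s s0 {Fs}.
- by move=> A; rewrite mem_cat => /orP[/Fs|/Ft].
- elim: s {s0 Fs} => [|A s IH] /=; first by rewrite comp_polyX.
  by rewrite -IH comp_polyA.
Qed.

Definition generated_semigroup F : Type := set_type (compositions F).

HB.instance Definition _ F := Choice.on (generated_semigroup F).

Definition generated_mul F (x y : generated_semigroup F) :
    generated_semigroup F :=
  SigSub (mem_set (compositions_comp (set_valP x) (set_valP y))).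

Lemma generated_mulA F : associative (@generated_mul F).
Proof. by move=> x y z; apply: val_inj; rewrite /= comp_polyA. Qed.

HB.instance Definition _ F :=
  isSemigroup.Build (generated_semigroup F) (@generated_mulA F).

End Polynomials.

(* [chebyshev n] is the polynomial [T_n] with [T_n (cos x) = cos (n x)] *)
Lemma chebyshev_cos (R : realType) (n : nat) (x : R) :
  (chebyshev R n).[cos x] = cos (x *+ n).
Proof.
suff: (chebyshev R n).[cos x] = cos (x *+ n) /\
      (chebyshev R n.+1).[cos x] = cos (x *+ n.+1) by case.
elim: n => [|n [IH0 IH1]]; first by rewrite /= hornerX hornerC mulr0n cos0.
split=> //; rewrite -[chebyshev R n.+2]/('X * chebyshev R n.+1 *+ 2 - chebyshev R n).
rewrite hornerD hornerN hornerMn hornerM hornerX IH0 IH1.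
have -> : x *+ n = x *+ n.+1 - x by rewrite mulrSr addrK.
by rewrite (mulrSr x n.+1) cosB cosD; ring.
Qed.

Section BoundedFunctions.
Variables (R : realType) (S : Type).
Implicit Types f g : S -> R[i]^o.

Definition bounded_pred : {pred S -> R[i]^o} := mem [set f | bounded_fun f].

Record Linf := MkLinf { Linf_fun :> S -> R[i]^o ; _ : Linf_fun \in bounded_pred }.

HB.instance Definition _ := [isSub for Linf_fun].
HB.instance Definition _ := [Choice of Linf by <:].

Lemma normc_ge0 (z : R[i]) : 0 <= Normc.normc z.
Proof. by rewrite -ler0c; apply: (normr_ge0 z). Qed.

Lemma bounded_predP f :
  reflect (exists M : R, forall s, Normc.normc (f s) <= M) (f \in bounded_pred).
Proof.
apply: (iffP idP).
- rewrite inE => /= -[M [Mr H]]; exists (complex.Re (M + 1)) => s.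
  have : (Normc.normc (f s))%:C <= M + 1.
    exact: H (M + 1) (ltr_pwDr ltr01 (lexx M)) s I.
  by rewrite lecE => /andP[].
- move=> [M H]; rewrite inE /=; exists M%:C; split.
    by rewrite realE !lecE /= eqxx /= le_total.
  move=> x Mx s _ /=; apply: le_trans (ltW Mx); rewrite -[leLHS]/((Normc.normc _)%:C).
  by rewrite lecR.
Qed.

Lemma bounded_submod_closed : submod_closed bounded_pred.
Proof.
split.
  by apply/bounded_predP; exists 0 => s; rewrite Normc.normc0.
move=> a f g /bounded_predP[M fM] /bounded_predP[N gN].
apply/bounded_predP; exists (Normc.normc a * M + N) => s.
rewrite -lecR; apply: le_trans (ler_normD (a * f s : R[i]) (g s)) _.
rewrite -rmorphD lecR Normc.normcM lerD //.
by rewrite ler_wpM2l ?normc_ge0.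
Qed.

HB.instance Definition _ :=
  GRing.isSubmodClosed.Build _ _ bounded_pred bounded_submod_closed.
HB.instance Definition _ := [SubChoice_isSubLmodule of Linf by <:].


(* The sup norm; [sup] over an empty [S] is 0. *)
Definition sup_norm (phi : Linf) : R :=
  sup (range (fun s => Normc.normc (phi s))).

Lemma le_sup_norm (phi : Linf) s : Normc.normc (phi s) <= sup_norm phi.
Proof.
have /bounded_predP[M phiM] := valP phi.
by apply: ub_le_sup; [exists M => _ [t _ <-]; exact: phiM | exists s].
Qed.

Lemma sup_norm_ge0 (phi : Linf) : 0 <= sup_norm phi.
Proof.
rewrite /sup_norm; have [[_ [s _ _]]|/set0P/negP/negPn/eqP ->] :=
  pselect (range (fun s => Normc.normc (phi s)) !=set0); last by rewrite sup0.
exact: le_trans (normc_ge0 (phi s)) (le_sup_norm phi s).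
Qed.

Lemma sup_norm_le (phi : Linf) (M : R) :
  0 <= M -> (forall s, Normc.normc (phi s) <= M) -> sup_norm phi <= M.
Proof.
move=> M0 phiM; rewrite /sup_norm.
have [E|/set0P/negP/negPn/eqP ->] :=
  pselect (range (fun s => Normc.normc (phi s)) !=set0); last by rewrite sup0.
by apply: ge_sup => // _ [t _ <-]; exact: phiM.
Qed.

Lemma sup_normD (phi psi : Linf) :
  (sup_norm (phi + psi))%:C <= (sup_norm phi)%:C + (sup_norm psi)%:C.
Proof.
rewrite -rmorphD lecR; apply: sup_norm_le => [|s].
  by rewrite addr_ge0 ?sup_norm_ge0.
rewrite -lecR; apply: le_trans (ler_normD (phi s : R[i]) (psi s)) _.
by rewrite rmorphD /= lerD // lecR le_sup_norm.
Qed.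

Lemma sup_normZ (a : R[i]) (phi : Linf) :
  (sup_norm (a *: phi))%:C = `|a| * (sup_norm phi)%:C.
Proof.
rewrite -[`|a|]/((Normc.normc a)%:C) -rmorphM; congr (_ %:C).
have le_scale b psi : sup_norm (b *: psi) <= Normc.normc b * sup_norm psi.
  apply: sup_norm_le => [|s]; first by rewrite mulr_ge0 ?normc_ge0 ?sup_norm_ge0.
  by rewrite Normc.normcM ler_wpM2l ?normc_ge0 ?le_sup_norm.
apply/eqP; rewrite eq_le le_scale /=.
have [->|a0] := eqVneq a 0; first by rewrite Normc.normc0 mul0r sup_norm_ge0.
have na0 : 0 < Normc.normc a.
  by rewrite lt_neqAle normc_ge0 andbT eq_sym; apply: contra a0 => /eqP/Normc.eq0_normc ->.
rewrite -ler_pdivlMl // -Normc.normcV -{1}[phi]scale1r -(mulVf a0) -scalerA.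
exact: le_scale.
Qed.

Lemma sup_norm0_eq0 (phi : Linf) : (sup_norm phi)%:C = 0 -> phi = 0.
Proof.
move=> /complexI phi0; apply/val_inj/funext => s.
apply: Normc.eq0_normc; apply/eqP; rewrite eq_le normc_ge0 andbT.
by rewrite -[leRHS]phi0 le_sup_norm.
Qed.

HB.instance Definition _ :=
  Lmodule_isNormed.Build R[i] Linf sup_normD sup_normZ sup_norm0_eq0.

Lemma bounded_const1 : (fun=> 1) \in bounded_pred.
Proof. by apply/bounded_predP; exists 1 => s; rewrite Normc.normc1. Qed.

(* the characteristic function of the whole of [S] *)
Definition Linf_one : Linf := MkLinf bounded_const1.

Lemma bounded_reindex (u : S -> S) (phi : Linf) :
  (fun x => phi (u x)) \in bounded_pred.
Proof.
have /bounded_predP[M phiM] := valP phi.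
by apply/bounded_predP; exists M => s; exact: phiM.
Qed.

Definition Linf_reindex (u : S -> S) (phi : Linf) : Linf :=
  MkLinf (bounded_reindex u phi).

Definition op_norm (M : {linear Linf -> R[i]^o}) : R :=
  sup [set Normc.normc (M phi) | phi in [set phi : Linf | `|phi| <= 1]].

(* The order of [R[i]] is partial: [0 <= z] says that [z] is real and
   nonnegative. *)
Definition is_mean (M : {linear Linf -> R[i]^o}) : Prop :=
  [/\ continuous M,
      forall phi : Linf, (forall s, 0 <= (phi s : R[i])) -> 0 <= (M phi : R[i]),
      op_norm M = 1 & M Linf_one = 1].

End BoundedFunctions.

Section Amenability.
Variables (R : realType) (S : semigroupType).
Local Notation Linf := (Linf R S).

Definition rtrans (s : S) (phi : Linf) : Linf :=
  Linf_reindex (fun x => (x * s)%g) phi.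

Definition ltrans (s : S) (phi : Linf) : Linf :=
  Linf_reindex (fun x => (s * x)%g) phi.

Definition RIM : set {linear Linf -> R[i]^o} :=
  [set M | is_mean M /\ forall s phi, M (rtrans s phi) = M phi].

Definition LIM : set {linear Linf -> R[i]^o} :=
  [set M | is_mean M /\ forall s phi, M (ltrans s phi) = M phi].

Definition amenable : Prop := RIM `&` LIM !=set0.

End Amenability.

Arguments RIM R S : clear implicits.
Arguments LIM R S : clear implicits.
Arguments amenable R S : clear implicits.

(* Main.v *)
From HB Require Import structures.
Require Import Defs.
From mathcomp Require Import all_boot all_order all_algebra all_solvable.
From mathcomp Require Import all_classical all_reals all_analysis.
From mathcomp Require Import complex ring zify.

Set Implicit Arguments.
Unset Strict Implicit.
Unset Printing Implicit Defensive.

Import Order.TTheory GRing.Theory Num.Theory.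
Import numFieldNormedType.Exports.

Local Open Scope classical_set_scope.
Local Open Scope ring_scope.

(* Conjugating by a translation, a non-exceptional P0 in F of degree d >= 2 becomes
   a polynomial T without term of degree d - 1 ("centered") which is not a
   monomial, and then every element of the semigroup is centered and commutes
   with some iterate of T.  If A and B are centered of the same degree and
   A o P = B o Q with deg P = deg Q, then P = w Q for a scalar w; a variant of the
   same degree count shows that two polynomials of the same degree commuting with
   T^M differ by a rotation w with T^M(w z) = w T^M(z).  As T is not a monomial,
   these rotations have order dividing a fixed N, and this order is prime to d.
   Hence the semigroup S is cancellative, has at most N elements of each degree,
   and some iterate z = T^K is central in S.

   Consequently S splits into finitely many classes x ~ y <-> x z^a = y z^b, which
   left and right translations permute.  Averaging a Banach limit along the orbits
   x_i z^n gives a right invariant mean.  On each class, left translation by s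
   coincides up to powers of z with right translation by some t, so that right
   invariant means are left invariant. *)

(** * Composition and leading coefficients *)

Section TopCoefficients.
Variable K : fieldType.
Implicit Types A B P Q : {poly K}.

Lemma size_mul_le m l P Q :
  (size P <= m.+1)%N -> (size Q <= l.+1)%N -> (size (P * Q)%R <= (m + l).+1)%N.
Proof. by move=> Pm Ql; apply: leq_trans (size_polyMleq _ _) _; lia. Qed.

Lemma coef_mul_top m l P Q :
  (size P <= m.+1)%N -> (size Q <= l.+1)%N -> (P * Q)`_(m + l) = P`_m * Q`_l.
Proof.
move=> Pm Ql; have mP : (m < (m + l).+1)%N by lia.
rewrite coefM (bigD1 (Ordinal mP)) //= addKn big1 ?addr0 // => i /eqP im.
have [mi|mi] := leqP (size P) i; first by rewrite nth_default ?mul0r.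
rewrite [Q`__]nth_default ?mulr0 //; apply: leq_trans Ql _.
suff : i != m :> nat by move=> ?; lia.
by apply/eqP => im'; apply: im; apply: val_inj.
Qed.

Lemma size_exp_le m i P : (size P <= m.+1)%N -> (size (P ^+ i) <= (i * m).+1)%N.
Proof. by move=> Pm; apply: leq_trans (size_poly_exp_leq _ _) _; nia. Qed.

Lemma coef_exp_top m i P : (size P <= m.+1)%N -> (P ^+ i)`_(i * m) = P`_m ^+ i.
Proof.
move=> Pm; elim: i => [|i IH]; first by rewrite mul0n !expr0 coef1.
by rewrite !exprS mulSn coef_mul_top ?size_exp_le ?IH.
Qed.

(** The quotient of A(P) - A(Q) by P - Q, expanded through the factorization of P^i - Q^i so that
    its degree and top coefficient can be read off. *)
Definition comp_quotient A P Q : {poly K} :=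
  \sum_(i < size A) A`_i *: \sum_(j < i) P ^+ (i.-1 - j) * Q ^+ j.

Lemma comp_polyB_quotient A P Q :
  (A \Po P) - (A \Po Q) = (P - Q) * comp_quotient A P Q.
Proof.
rewrite !comp_polyE -sumrB /comp_quotient mulr_sumr; apply: eq_bigr => i _.
by rewrite -scalerBr subrXX scalerAr.
Qed.

Lemma size_power_sum n i P Q :
  (size P <= n.+1)%N -> (size Q <= n.+1)%N ->
  (size (\sum_(j < i) P ^+ (i.-1 - j) * Q ^+ j)%R <= (i.-1 * n).+1)%N.
Proof.
move=> Pn Qn; apply: (leq_trans (size_sum _ _ _)); apply/bigmax_leqP => j _.
have := size_mul_le (size_exp_le (i.-1 - j) Pn) (size_exp_le j Qn).
by rewrite -mulnDl subnK //; case: i j => [[]|i j] //=; rewrite -ltnS.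
Qed.

Lemma size_comp_quotient n k A P Q : 
  (size A <= k.+1)%N -> (size P <= n.+1)%N -> (size Q <= n.+1)%N ->
  (size (comp_quotient A P Q) <= (k.-1 * n).+1)%N.
Proof.
move=> Ak Pn Qn; apply: (leq_trans (size_sum _ _ _)); apply/bigmax_leqP => i _.
apply: leq_trans (size_scale_leq _ _) _; apply: leq_trans (size_power_sum _ Pn Qn) _.
by have := ltn_ord i; rewrite ltnS leq_mul2r => ?; apply/orP; right; lia.
Qed.

(** Since P and Q agree at index n, the k products P^(k-1-j) Q^j contribute equally and add up to a
    multiple by k; the indices i < k stay below degree (k - 1)n. *)
Lemma coef_comp_quotient n k A P Q :
  (0 < n)%N -> (0 < k)%N ->
  (size A <= k.+1)%N -> (size P <= n.+1)%N -> (size Q <= n.+1)%N ->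
  P`_n = Q`_n ->
  (comp_quotient A P Q)`_(k.-1 * n) = A`_k * P`_n ^+ k.-1 *+ k.
Proof.
move=> n0 k0 Ak Pn Qn PQ; rewrite /comp_quotient coef_sum.
have small (i : nat) : (i < k)%N ->
    (\sum_(j < i) P ^+ (i.-1 - j) * Q ^+ j)`_(k.-1 * n) = 0.
  move=> ik; have [->|i0] := posnP i; first by rewrite big_ord0 coef0.
  rewrite nth_default //; apply: leq_trans (size_power_sum _ Pn Qn) _.
  by rewrite ltn_mul2r n0 /=; lia.
have top : (\sum_(j < k) P ^+ (k.-1 - j) * Q ^+ j)`_(k.-1 * n) = P`_n ^+ k.-1 *+ k.
  rewrite coef_sum; under eq_bigr => j _.
    have jk : (j <= k.-1)%N by have := ltn_ord j; lia.
    rewrite -{2}(subnK jk) mulnDl coef_mul_top ?size_exp_le //.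
    rewrite !coef_exp_top // -PQ -exprD subnK //.
    over.
  by rewrite sumr_const card_ord.
have [Ak'|kA] := leqP (size A) k.
  rewrite big1 => [|i _]; last first.
    by rewrite coefZ small ?mulr0 // (leq_trans (ltn_ord i)).
  by rewrite [A`_k]nth_default // mul0r mul0rn.
rewrite (bigD1 (Ordinal kA)) //= coefZ top -mulrnAr big1 ?addr0 // => i /eqP ik.
rewrite coefZ small ?mulr0 // ltn_neqAle -ltnS (leq_trans (ltn_ord i)) // andbT.
by apply/eqP => ik'; apply: ik; apply: val_inj.
Qed.

End TopCoefficients.

(** * Rigidity of compositions with centered left factors *)

Section Rigidity.
Variable K : fieldType.
Implicit Types A B P Q : {poly K}.

Lemma size_comp_le n k A P :
  (size A <= k.+1)%N -> (size P <= n.+1)%N -> (size (A \Po P) <= (k * n).+1)%N.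
Proof. by move=> Ak Pn; apply: leq_trans (size_comp_poly_leq _ _) _; nia. Qed.

Lemma coef_comp_top n k A P :
  (0 < n)%N -> (size A <= k.+1)%N -> (size P <= n.+1)%N ->
  (A \Po P)`_(k * n) = A`_k * P`_n ^+ k.
Proof.
move=> n0 Ak Pn; rewrite coef_comp_poly.
have small (i : nat) : (i < k)%N -> (P ^+ i)`_(k * n) = 0.
  move=> ik; rewrite nth_default //; apply: leq_trans (size_exp_le i Pn) _.
  by rewrite ltn_mul2r n0.
have [Ak'|kA] := leqP (size A) k.
  rewrite big1 => [|i _]; last by rewrite small ?mulr0 // (leq_trans (ltn_ord i)).
  by rewrite [A`_k]nth_default // mul0r.
rewrite (bigD1 (Ordinal kA)) //= coef_exp_top // big1 ?addr0 // => i /eqP ik.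
rewrite small ?mulr0 // ltn_neqAle -ltnS (leq_trans (ltn_ord i)) // andbT.
by apply/eqP => ik'; apply: ik; apply: val_inj.
Qed.

Lemma coef_comp_scaleX (w : K) A i : (A \Po (w *: 'X))`_i = A`_i * w ^+ i.
Proof.
rewrite coef_comp_poly; under eq_bigr => j _ do rewrite exprZn coefZ coefXn.
have [Ai|iA] := leqP (size A) i.
  rewrite big1 => [|j _]; first by rewrite nth_default // mul0r.
  by rewrite gtn_eqF ?mulr0 // (leq_trans (ltn_ord j)).
rewrite (bigD1 (Ordinal iA)) //= eqxx mulr1 big1 ?addr0 // => j /eqP ji.
case: eqP => [ij|]; last by rewrite !mulr0.
by case: ji; apply: val_inj.
Qed.

(* Let E = P - w Q <> 0 of degree e < n = deg P, and k = deg A. Then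
   A(P) - A(wQ) has degree exactly (k - 1)n + e, whereas A(wQ) - B(Q) has degree
   at most (k - 2)n because A and B have no term of degree k - 1. *)
Lemma comp_rigid n k (w : K) A B P Q :
  k%:R != 0 :> K -> (1 < k)%N -> (0 < n)%N ->
  size A = k.+1 -> (size B <= k.+1)%N -> size P = n.+1 -> size Q = n.+1 ->
  A`_k.-1 = 0 -> B`_k.-1 = 0 -> P`_n = w * Q`_n ->
  (size ((A \Po P) - (B \Po Q))%R <= ((size (P - w *: Q)%R).-1 * k).+1)%N ->
  P = w *: Q.
Proof.
move=> k0 k1 n0 sA sB sP sQ A0 B0 PQ; set E := P - w *: Q => small.
apply/eqP; rewrite -subr_eq0 -/E; apply/negP => /negP E0.
have lastn0 (X : {poly K}) m : size X = m.+1 -> X`_m != 0.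
  by move=> sX; rewrite -[m]/(m.+1.-1) -sX -lead_coefE lead_coef_eq0 -size_poly_gt0 sX.
have [p0 q0 a0] := And3 (lastn0 _ _ sP) (lastn0 _ _ sQ) (lastn0 _ _ sA).
have swQ : (size (w *: Q)%R <= n.+1)%N by rewrite -sQ size_scale_leq.
have [e sE] : exists e, size E = e.+1.
  by case: (size E) (size_poly_gt0 E) => [|e]; [rewrite (negbTE E0)|exists e].
have en : (e < n)%N.
  rewrite -sE; apply/leq_sizeP => i; rewrite leq_eqVlt => /orP[/eqP <-|ni].
    by rewrite coefB coefZ PQ subrr.
  by rewrite coefB coefZ !nth_default ?mulr0 ?subrr // ?sP ?sQ.
(* [small] now bounds the degree of A(P) - B(Q) by ek, which is below both kn and e + (k - 1)n
   because e < n and k > 1. *)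
rewrite sE /= in small.
have top0 : A`_k * w ^+ k = B`_k.
  have : ((A \Po P) - (B \Po Q))`_(k * n) = 0.
    by rewrite nth_default //; apply: leq_trans small _; nia.
  rewrite coefB !coef_comp_top ?sA ?sP ?sQ // PQ exprMn mulrA -mulrBl => /eqP.
  by rewrite mulf_eq0 subr_eq0 expf_eq0 (negbTE q0) andbF orbF => /eqP.
have sC : (size ((A \Po (w *: 'X)) - B)%R <= k.-1)%N.
  apply/leq_sizeP => i ki; rewrite coefB coef_comp_scaleX.
  have [ik|ik] := leqP i k; last by rewrite !nth_default ?mul0r ?subrr ?sA // (leq_trans sB).
  have [->|ik'] := eqVneq i k; first by rewrite top0 subrr.
  have -> : i = k.-1 by lia.
  by rewrite A0 B0 mul0r subrr.
have AwQ : A \Po (w *: Q) = (A \Po (w *: 'X)) \Po Q.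
  by rewrite -comp_polyA comp_polyZ comp_polyX.
have dec : (A \Po P) - (B \Po Q) =
    ((A \Po P) - (A \Po (w *: Q))) + (((A \Po (w *: 'X)) - B) \Po Q).
  by rewrite comp_polyB -AwQ addrA subrK.
have PwQ : P`_n = (w *: Q)`_n by rewrite coefZ.
(* In this degree the product of E with the quotient has a nonzero coefficient, while all other
   terms of [dec] vanish. *)
have := congr1 (fun X : {poly K} => X`_(e + k.-1 * n)) dec.
move=> /=; rewrite [in RHS]coefD (comp_polyB_quotient A P) -/E.
rewrite (@coef_mul_top _ e (k.-1 * n)) ?sE //; last first.
  by rewrite size_comp_quotient ?sA ?sP.
rewrite coef_comp_quotient ?sA ?sP //; last by lia.
rewrite nth_default; last by apply: leq_trans small _; nia.
rewrite [X in _ + X]nth_default ?addr0; last first.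
  have sQ' : (size Q <= n.+1)%N by rewrite sQ.
  have sC' : (size ((A \Po (w *: 'X)) - B)%R <= k.-2.+1)%N by apply: leq_trans sC _; lia.
  apply: leq_trans (size_comp_le sC' sQ') _; nia.
move=> /esym/eqP; rewrite mulf_eq0 (negbTE (lastn0 _ _ sE)) -mulr_natr !mulf_eq0.
by rewrite (negbTE a0) expf_eq0 (negbTE p0) (negbTE k0) andbF.
Qed.

End Rigidity.

(** * Degrees, iterates and centered polynomials *)

Section Iterates.
Variable K : fieldType.
Implicit Types A B P Q : {poly K}.

(** The zero polynomial gets degree 0 like the other constants, so that degrees multiply under
    composition without any hypothesis. *)
Definition deg P := (size P).-1.

Lemma coef_deg_neq0 P : (1 < size P)%N -> P`_(deg P) != 0.
Proof. by move=> sP; rewrite -lead_coefE lead_coef_eq0 -size_poly_gt0; lia. Qed.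

Lemma deg_comp P Q : deg (P \Po Q) = (deg P * deg Q)%N.
Proof. exact: size_comp_poly. Qed.

Lemma poly_iterD m n P : poly_iter (m + n) P = poly_iter m P \Po poly_iter n P.
Proof.
elim: m => [|m IH]; first by rewrite comp_polyX.
by rewrite addSn [LHS]/= -/(poly_iter _ _) IH comp_polyA.
Qed.

Lemma poly_iterM m n P : poly_iter (m * n) P = poly_iter m (poly_iter n P).
Proof. by elim: m => [|m IH]; rewrite ?mulSn ?poly_iterD ?IH. Qed.

Lemma deg_iter n P : deg (poly_iter n P) = (deg P ^ n)%N.
Proof.
elim: n => [|n IH]; first by rewrite /deg size_polyX.
by rewrite expnS -IH -deg_comp.
Qed.

Lemma comp_poly_injl P : (1 < size P)%N -> injective (fun A => A \Po P).
Proof.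
move=> P1 A B /= AB; apply/eqP; rewrite -subr_eq0 -(comp_poly_eq0 _ P1).
by rewrite comp_polyB AB subrr.
Qed.

Lemma size_comp_scaleX (w : K) A : w != 0 -> size (A \Po (w *: 'X)) = size A.
Proof. by move=> w0; apply: size_comp_poly2; rewrite size_scale ?size_polyX. Qed.

Definition commutes A B := A \Po B = B \Po A.

Lemma commutes_comp A B C : commutes A C -> commutes B C -> commutes (A \Po B) C.
Proof. by move=> cA cB; rewrite /commutes -comp_polyA cB comp_polyA cA comp_polyA. Qed.

Lemma commutes_iterr n A B : commutes A B -> commutes A (poly_iter n B).
Proof.
move=> AB; elim: n => [|n IH]; first by rewrite /commutes comp_polyX comp_polyXr.
rewrite /commutes /= -/(poly_iter n B) comp_polyA AB -comp_polyA IH comp_polyA.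
by [].
Qed.

Definition centered P := P`_(size P).-2 = 0.

(** With p the coefficient of P at n, A(pX^n) is a polynomial in X^n and has no term of degree kn -
    1 because n > 1. Only P - pX^n times the quotient contributes, through its top coefficient. *)
Lemma coef_comp_subtop n k A P :
  (1 < n)%N -> (0 < k)%N -> (size A <= k.+1)%N -> (size P <= n.+1)%N ->
  (A \Po P)`_(k * n).-1 = A`_k * P`_n ^+ k.-1 * P`_n.-1 *+ k.
Proof.
move=> n1 k0 Ak Pn; have nk : (k * n).-1 = (n.-1 + k.-1 * n)%N by nia.
set Q := P`_n *: 'X^n.
have sQ : (size Q <= n.+1)%N by apply: leq_trans (size_scale_leq _ _) _; rewrite size_polyXn.
have Qn : Q`_n = P`_n by rewrite coefZ coefXn eqxx mulr1.
have sE : (size (P - Q)%R <= n.-1.+1)%N.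
  apply/leq_sizeP => i ni; have [<-|ni'] := eqVneq n i; first by rewrite coefB Qn subrr.
  by rewrite coefB !nth_default ?subrr //; apply: leq_trans (_ : n.+1 <= i)%N => //; lia.
have -> : A \Po P = (P - Q) * comp_quotient A P Q + (A \Po Q).
  by rewrite -comp_polyB_quotient subrK.
have -> : A \Po Q = (A \Po (P`_n *: 'X)) \Po 'X^n.
  by rewrite -comp_polyA comp_polyZ comp_polyX.
rewrite coefD coef_comp_poly_Xn; last by lia.
rewrite ifN ?addr0; last first.
  apply/negP => /dvdnP[d dE]; have : (k * n = d * n + 1)%N by nia.
  by move=> /(congr1 (modn^~ n)); rewrite /= modnMl modnMDl modn_small; lia.
rewrite nk coef_mul_top //; last exact: size_comp_quotient.
rewrite coef_comp_quotient //; last by lia.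
rewrite coefB coefZ coefXn (_ : (n.-1 == n) = false) ?mulr0 ?subr0; last by lia.
by rewrite mulrnAr mulrC.
Qed.

End Iterates.

(** * Centered polynomials in characteristic 0 *)

Section Commuting.
Variable K : fieldType.
Hypothesis K0 : [pchar K] =i pred0.
Implicit Types A B P Q W X Y : {poly K}.

(** The subleading coefficient of the composite is that of P times a factor which is nonzero in
    characteristic 0, so only the inner polynomial matters. *)
Lemma centered_comp A P : (1 < size A)%N -> (2 < size P)%N ->
  centered (A \Po P) <-> centered P.
Proof.
move=> sA sP; rewrite /centered.
have [[k sAk] [n sPn]] : (exists k, size A = k.+2) /\ (exists n, size P = n.+3).
  by case: (size A) (size P) sA sP => [|[|k]] [|[|[|n]]] //; split; eexists.
have -> : (size (A \Po P)).-2 = (k.+1 * n.+2).-1 by rewrite size_comp_poly sAk sPn.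
rewrite (@coef_comp_subtop _ n.+2 k.+1) ?sAk ?sPn //=.
split=> [/eqP|->]; last by rewrite mulr0 mul0rn.
have lastn0 (Z : {poly K}) m : size Z = m.+1 -> Z`_m != 0.
  by move=> sX; rewrite -[m]/(m.+1.-1) -sX -lead_coefE lead_coef_eq0 -size_poly_gt0 sX.
rewrite -mulr_natr !mulf_eq0 ((pcharf0P K).1 K0) orbF (negbTE (lastn0 _ _ sAk)).
by rewrite expf_eq0 (negbTE (lastn0 _ _ sPn)) andbF => /eqP.
Qed.

Lemma centered_iter n P : (0 < n)%N -> (2 < size P)%N ->
  centered (poly_iter n P) <-> centered P.
Proof.
move=> n0 sP; rewrite -(prednK n0) -addn1 poly_iterD.
have -> : poly_iter 1 P = P by exact: comp_polyXr.
apply: centered_comp => //; rewrite -ltn_predRL -/(deg _) deg_iter expn_gt0 /deg.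
by apply/orP; left; lia.
Qed.

Lemma comp_scale_eq P w : w != 0 -> (1 < size P)%N -> forall A B,
  A \Po P = B \Po (w *: P) -> A = B \Po (w *: 'X).
Proof.
move=> w0 sP A B AB; apply: (comp_poly_injl sP) => /=.
by rewrite -comp_polyA comp_polyZ comp_polyX.
Qed.

Lemma decomposition_unique A B P Q :
  size A = size B -> (2 < size A)%N -> size P = size Q -> (1 < size P)%N ->
  centered A -> centered B -> A \Po P = B \Po Q ->
  exists2 w, w != 0 & P = w *: Q.
Proof.
move=> AB sA PQ sP cA cB e.
have lP0 : lead_coef P != 0 by rewrite lead_coef_eq0 -size_poly_gt0; lia.
have lQ0 : lead_coef Q != 0 by rewrite lead_coef_eq0 -size_poly_gt0; lia.
set w := lead_coef P / lead_coef Q.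
have w0 : w != 0 by rewrite mulf_neq0 // invr_eq0.
exists w => //; apply: (@comp_rigid _ (deg P) (deg A) w A B).
- by rewrite ((pcharf0P K).1 K0) /deg; lia.
- by rewrite /deg; lia.
- by rewrite /deg; lia.
- by rewrite /deg; lia.
- by rewrite /deg; lia.
- by rewrite /deg; lia.
- by rewrite /deg; lia.
- exact: cA.
- by rewrite /deg AB; exact: cB.
- by rewrite /deg {2}PQ -!lead_coefE divfK.
by rewrite e subrr size_poly0.
Qed.

(** Take w to be the ratio of the leading coefficients. Then W(X) - wW(Y) = (X - wY)(W) has degree
    at most deg (X - wY) times deg W, which is the bound required by [comp_rigid]. Cancelling Y on
    the right in W(wY) = wW(Y) gives the second claim. *)
Lemma commuting_same_degree W X Y :
  (2 < size W)%N -> centered W -> size X = size Y -> (1 < size X)%N ->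
  commutes X W -> commutes Y W ->
  exists2 w, w != 0 & X = w *: Y /\ W \Po (w *: 'X) = w *: W.
Proof.
move=> sW cW XY sX cXW cYW.
have lX0 : lead_coef X != 0 by rewrite lead_coef_eq0 -size_poly_gt0; lia.
have lY0 : lead_coef Y != 0 by rewrite lead_coef_eq0 -size_poly_gt0; lia.
set w := lead_coef X / lead_coef Y.
have w0 : w != 0 by rewrite mulf_neq0 // invr_eq0.
have XE : X = w *: Y.
  apply: (@comp_rigid _ (deg X) (deg W) w W (w *: W)).
  - by rewrite ((pcharf0P K).1 K0) /deg; lia.
  - by rewrite /deg; lia.
  - by rewrite /deg; lia.
  - by rewrite /deg; lia.
  - by apply: leq_trans (size_scale_leq _ _) _; rewrite /deg; lia.
  - by rewrite /deg; lia.
  - by rewrite /deg; lia.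
  - exact: cW.
  - by rewrite coefZ [W`__]cW mulr0.
  - by rewrite /deg {2}XY -!lead_coefE divfK.
  have -> : (W \Po X) - ((w *: W) \Po Y) = (X - w *: Y) \Po W.
    by rewrite comp_polyB !comp_polyZ -cXW -cYW.
  by apply: leq_trans (size_comp_poly_leq _ _) _.
exists w => //; split=> //; apply/esym.
apply: comp_scale_eq w0 (_ : 1 < size Y)%N _ _ _; first by rewrite -XY.
by rewrite -XE -cXW XE !comp_polyZ cYW.
Qed.

End Commuting.

(** * Polynomials commuting with an iterate of T *)

Section CommutingFamily.
Variable K : fieldType.
Hypothesis K0 : [pchar K] =i pred0.
Variable T : {poly K}.
Hypotheses (sT : (2 < size T)%N) (cT : centered T).
Implicit Types A B Q X Y : {poly K}.

(** The valuation of the degree at a fixed prime factor of deg T serves as an additive,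
    integer-valued substitute for the logarithm of the degree. *)
Definition degval A := logn (pdiv (deg T)) (deg A).

(** These conditions pass to compositions and hold for every Q sharing an iterate with T. The last
    one makes deg A a rational power of deg T, so that [degval A] determines deg A. *)
Definition tame A := [/\ (2 < size A)%N, centered A,
  (exists2 M, (0 < M)%N & commutes A (poly_iter M T)) &
  (deg A ^ degval T = deg T ^ degval A)%N].

Definition symmetry (w : K) :=
  w != 0 /\ exists2 M, (0 < M)%N & commutes (w *: 'X) (poly_iter M T).

Lemma deg_gt1 A : (1 < deg A)%N = (2 < size A)%N.
Proof. by rewrite /deg; lia. Qed.

Lemma degvalT_gt0 : (0 < degval T)%N.
Proof.
have dT : (1 < deg T)%N by rewrite deg_gt1.
by rewrite /degval logn_gt0 mem_primes pdiv_prime // pdiv_dvd (ltnW dT).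
Qed.

Lemma degval_comp A B : tame A -> tame B ->
  degval (A \Po B) = (degval A + degval B)%N.
Proof.
by move=> [sA _ _ _] [sB _ _ _]; rewrite /degval deg_comp lognM // /deg; lia.
Qed.

Lemma tame_deg_inj A B : tame A -> tame B -> degval A = degval B -> size A = size B.
Proof.
move=> [sA _ _ dA] [sB _ _ dB] AB; have : deg A = deg B.
  by apply/eqP; rewrite -(eqn_exp2r _ _ degvalT_gt0) dA dB AB.
by rewrite /deg; lia.
Qed.

Lemma commutes_iter_common A B :
  (exists2 M, (0 < M)%N & commutes A (poly_iter M T)) ->
  (exists2 M, (0 < M)%N & commutes B (poly_iter M T)) ->
  exists2 M, (0 < M)%N &
    commutes A (poly_iter M T) /\ commutes B (poly_iter M T).
Proof.
move=> [m m0 Am] [n n0 Bn]; exists (m * n)%N; first by rewrite muln_gt0 m0.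
split; last by rewrite poly_iterM; exact: commutes_iterr.
by rewrite mulnC poly_iterM; exact: commutes_iterr.
Qed.

Lemma size_iter_gt2 M : (0 < M)%N -> (2 < size (poly_iter M T))%N.
Proof.
move=> M0; rewrite -deg_gt1 deg_iter.
by rewrite -{1}(exp1n M) ltn_exp2r // deg_gt1.
Qed.

Lemma tame_comp A B : tame A -> tame B -> tame (A \Po B).
Proof.
move=> tA tB; have := degval_comp tA tB.
move: tA tB => [sA cA iA dA] [sB cB iB dB] dAB; split.
- by rewrite -deg_gt1 deg_comp; move: sA sB; rewrite -!deg_gt1; nia.
- by apply/(centered_comp K0) => //; lia.
- have [M M0 [AM BM]] := commutes_iter_common iA iB.
  by exists M => //; exact: commutes_comp.
- by rewrite dAB deg_comp expnMn expnD dA dB.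
Qed.

(** Being centered passes from T to the common iterate and back to Q, and Q commutes with its own
    iterate. The degree relation follows from (deg T)^m = (deg Q)^n by taking valuations and
    comparing n-th powers. *)
Lemma tame_root m n Q : (0 < m)%N -> (0 < n)%N ->
  poly_iter m T = poly_iter n Q -> tame Q.
Proof.
move=> m0 n0 TQ; have := congr1 (@deg K) TQ; rewrite !deg_iter => dTQ.
have dT : (1 < deg T)%N by rewrite deg_gt1.
have dQ : (1 < deg Q)%N.
  rewrite ltnNge; apply/negP => Q1.
  have : (deg Q ^ n <= 1)%N by rewrite -(exp1n n) leq_exp2r.
  by rewrite -dTQ leqNgt -{1}(exp1n m) ltn_exp2r ?dT.
have sQ : (2 < size Q)%N by rewrite -deg_gt1.
split=> //.
- by apply/(centered_iter K0 n0 sQ); rewrite -TQ; apply/(centered_iter K0).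
- by exists m => //; rewrite TQ; exact: commutes_iterr.
- have vTQ : (m * degval T = n * degval Q)%N.
    by rewrite /degval -!lognX dTQ.
  apply/eqP; rewrite -(eqn_exp2r _ _ n0) -!expnM [(_ * n)%N]mulnC expnM -dTQ -expnM.
  by rewrite vTQ mulnC.
Qed.

Lemma tame_id : tame T.
Proof. exact: (@tame_root 1 1). Qed.

Lemma tame_ratio A B : tame A -> tame B -> size A = size B ->
  exists2 w, symmetry w & A = w *: B.
Proof.
move=> [sA _ iA _] [sB _ iB _] AB.
have [M M0 [AM BM]] := commutes_iter_common iA iB.
have [|||w w0 [-> wM]] := commuting_same_degree K0 _ _ AB _ AM BM.
- exact: size_iter_gt2.
- exact/(centered_iter K0).
- by lia.
exists w => //; split=> //; exists M => //.
by rewrite /commutes comp_polyZ comp_polyX.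
Qed.

(** Both A(wX) and A commute with a common iterate of T and have the same degree, hence are
    proportional; leading coefficients give the factor. *)
Lemma comp_symmetry A w : tame A -> symmetry w ->
  A \Po (w *: 'X) = w ^+ deg A *: A.
Proof.
move=> [sA cA iA _] [w0 iw].
have [M M0 [AM wM]] := commutes_iter_common iA iw.
have sAw : size (A \Po (w *: 'X)) = size A by exact: size_comp_scaleX.
have [|||v v0 [Av _]] := commuting_same_degree K0 _ _ sAw _ (commutes_comp AM wM) AM.
- exact: size_iter_gt2.
- exact/(centered_iter K0).
- by lia.
have : v = w ^+ deg A; last by rewrite Av => ->.
have := congr1 (fun P : {poly K} => P`_(deg A)) Av.
rewrite /= coef_comp_scaleX coefZ [v * _]mulrC => /mulfI/esym; apply.
by apply: coef_deg_neq0; exact: ltnW.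
Qed.

Definition geometric_sum k := (\sum_(i < k) deg T ^ i)%N.

Lemma geometric_sumS k : geometric_sum k.+1 = (1 + deg T * geometric_sum k)%N.
Proof.
rewrite /geometric_sum big_ord_recl expn0; congr addn; rewrite big_distrr.
by apply: eq_bigr => i _; rewrite expnS.
Qed.

(** A factor v already collected becomes v^(deg T) when it is pulled out of one more T, and a new w
    appears: this is the recurrence of the geometric sum. *)
Lemma commutation_factor A w k : symmetry w ->
  A \Po T = w *: (T \Po A) ->
  A \Po poly_iter k T = w ^+ geometric_sum k *: (poly_iter k T \Po A).
Proof.
move=> sw AT; elim: k => [|k IH].
  by rewrite /geometric_sum big_ord0 scale1r comp_polyX comp_polyXr.
rewrite [poly_iter _ _]/= -/(poly_iter k T) comp_polyA AT comp_polyZ -comp_polyA IH.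
set B := poly_iter k T \Po A; set v := w ^+ _.
have sv : symmetry v.
  case: sw => w0 [M M0 wM]; split; first by rewrite expf_neq0.
  exists M => //; rewrite /v; elim: (geometric_sum k) => [|j jM].
    by rewrite scale1r /commutes comp_polyX comp_polyXr.
  have -> : w ^+ j.+1 *: 'X = (w *: 'X) \Po (w ^+ j *: 'X) :> {poly K}.
    by rewrite comp_polyZ comp_polyX scalerA exprS.
  exact: commutes_comp.
rewrite -[v *: B](_ : (v *: 'X) \Po B = _); last by rewrite comp_polyZ comp_polyX.
rewrite comp_polyA (comp_symmetry tame_id sv) comp_polyZ scalerA /B comp_polyA.
by rewrite geometric_sumS /v -exprM exprD expr1 mulnC.
Qed.

Variable N : nat.
Hypothesis symT : forall w mu : K,
  w != 0 -> T \Po (w *: 'X) = mu *: T -> w ^+ N = 1.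

(** Leading coefficients in T^M(wX) = wT^M give the second claim. For the first, T^(M-1) o T(wX) =
    wT^(M-1) o T, and uniqueness of decompositions makes T(wX) proportional to T. *)
Lemma symmetry_order w : symmetry w ->
  w ^+ N = 1 /\ exists2 M, (0 < M)%N & w ^+ (deg T ^ M) = w.
Proof.
move=> [w0 [M M0]]; rewrite /commutes comp_polyZ comp_polyX => /esym wM.
split; last first.
  exists M => //; rewrite -deg_iter.
  have := congr1 (fun P : {poly K} => P`_(deg (poly_iter M T))) wM.
  rewrite /= coef_comp_scaleX coefZ [w * _]mulrC => /mulfI; apply.
  by apply: coef_deg_neq0; exact: ltnW (size_iter_gt2 M0).
(* For M = 1 the left factor T^(M-1) is X, too small for [decomposition_unique], but [symT] applies
   directly. *)
have [M1|M1] := leqP M 1.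
  have M1' : M = 1%N by lia.
  by apply: symT w0 _; move: wM; rewrite M1' [poly_iter 1 T]comp_polyXr => ->.
have M'0 : (0 < M.-1)%N by lia.
move: wM; rewrite -(prednK M0) -addn1 poly_iterD [poly_iter 1 T]comp_polyXr.
rewrite -comp_polyA -comp_polyZ => wM.
have swT : size (T \Po (w *: 'X)) = size T by exact: size_comp_scaleX.
have [||||||v v0 Tv] := decomposition_unique K0 _ _ _ _ _ _ wM.
- by rewrite size_scale.
- exact: size_iter_gt2.
- by [].
- by rewrite swT; lia.
- exact/(centered_iter K0).
- rewrite /centered coefZ size_scale // (_ : _`_ _ = 0) ?mulr0 //.
  exact/(centered_iter K0).
exact: symT w0 Tv.
Qed.

(* A symmetry has order prime to deg T, while a failure of left cancellation by A
   produces one whose order divides deg A, which has the same prime factors. *)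
Lemma tame_cancel A X Y : tame A -> tame X -> tame Y ->
  A \Po X = A \Po Y -> X = Y.
Proof.
move=> tA tX tY AXY; have := congr1 (@deg K) AXY; rewrite !deg_comp => dXY.
have sA : (2 < size A)%N by case: tA.
have sX : (2 < size X)%N by case: tX.
have sY : (2 < size Y)%N by case: tY.
have XY : size X = size Y.
  move/eqP: dXY; rewrite eqn_pmul2l; last by rewrite /deg; lia.
  by move=> /eqP; rewrite /deg; lia.
have [w sw XE] := tame_ratio tX tY XY.
suff : w = 1 by move=> w1; rewrite XE w1 scale1r.
have wA : w ^+ deg A = 1.
  move: AXY; rewrite XE -[w *: Y](_ : (w *: 'X) \Po Y = _); last first.
    by rewrite comp_polyZ comp_polyX.
  rewrite comp_polyA comp_symmetry // comp_polyZ => /eqP.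
  rewrite -{2}[A \Po Y]scale1r -subr_eq0 -scalerBl scaler_eq0 comp_poly_eq0; last exact: ltnW.
  rewrite subr_eq0 => /orP[/eqP //|/eqP A0].
  by rewrite A0 size_poly0 in sA.
have [_ [M M0 wM]] := symmetry_order sw.
have wM' k : w ^+ (deg T ^ (M * k)) = w.
  by elim: k => [|k IH]; rewrite ?muln0 // mulnS expnD exprM wM IH.
(* For such k, (deg T)^k is a multiple of (deg T)^(degval A) = (deg A)^(degval T), hence of deg
   A. *)
have wA' k : (degval A <= k)%N -> w ^+ (deg T ^ k) = 1.
  case: tA => _ _ _ dA Ak; rewrite -(subnKC Ak) expnD -dA exprM.
  by rewrite -(prednK degvalT_gt0) expnS exprM wA !expr1n.
by rewrite -(wM' (degval A)) wA' // leq_pmull.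
Qed.

Hypothesis N0 : (0 < N)%N.

(** The factorial is divisible by the totient of q(deg T - 1) for every positive q <= N, so one
    exponent serves symmetries of all orders q. *)
Definition central_exponent := (N * (deg T).-1)`!.

(** Let q be the order of w and D = deg T. As q divides D^M - 1, D is prime to q(D - 1), and Euler's
    theorem shows that q(D - 1) divides D^K - 1, K being the central exponent. Dividing by D - 1, q
    divides the geometric sum. *)
Lemma symmetry_geometric_sum w : symmetry w -> w ^+ geometric_sum central_exponent = 1.
Proof.
move=> sw; have [wN [M M0 wM]] := symmetry_order sw.
have w0 : w != 0 by case: sw.
have dT : (1 < deg T)%N by rewrite deg_gt1.
have dTM : (1 < deg T ^ M)%N by rewrite -{1}(exp1n M) ltn_exp2r.
have wM1 : w ^+ (deg T ^ M).-1 = 1.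
  by apply: (mulfI w0); rewrite -exprS prednK ?wM ?mulr1 //; lia.
have [d dw dN] := prim_order_exists N0 wN.
have dM : (d %| (deg T ^ M).-1)%N by rewrite (prim_order_dvd dw) wM1.
have d0 : (0 < d)%N := prim_order_gt0 dw.
have dcop : coprime (deg T) (d * (deg T).-1).
  rewrite coprimeMr; apply/andP; split; last by rewrite coprimenP //; lia.
  have : coprime (deg T ^ M) (deg T ^ M).-1 by rewrite coprimenP //; lia.
  by rewrite coprime_pexpl //; apply: coprime_dvdr.
apply/eqP; rewrite -(prim_order_dvd dw) -(@dvdn_pmul2r (deg T).-1); last by lia.
have -> : (geometric_sum central_exponent * (deg T).-1 = (deg T ^ central_exponent).-1)%N.
  by rewrite predn_exp mulnC.
have /dvdnP[k ->] : (totient (d * (deg T).-1) %| central_exponent)%N.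
  apply: dvdn_fact; rewrite totient_gt0 muln_gt0 d0 /= (_ : 0 < (deg T).-1)%N; last by lia.
  apply: leq_trans (_ : d * (deg T).-1 <= _)%N; last first.
    by rewrite leq_mul2r (dvdn_leq N0 dN) orbT.
  rewrite totient_count_coprime big_mkord.
  rewrite -[leqRHS]card_ord -sum1_card leq_sum // => i _; exact: leq_b1.
have := Euler_exp_totient dcop => /(congr1 (fun x => x ^ k %% (d * (deg T).-1)))%N.
rewrite !modnXm exp1n -expnM mulnC => /eqP.
by rewrite eqn_mod_dvd ?subn1 // expn_gt0; lia.
Qed.

Lemma tame_central A : tame A -> commutes A (poly_iter central_exponent T).
Proof.
move=> tA; have tT := tame_id.
have [|w sw AT] := tame_ratio (tame_comp tA tT) (tame_comp tT tA).
  have [[sAT _ _ _] [sTA _ _ _]] := (tame_comp tA tT, tame_comp tT tA).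
  by have := deg_comp A T; rewrite mulnC -deg_comp /deg; lia.
by rewrite /commutes (commutation_factor _ sw AT) symmetry_geometric_sum ?scale1r.
Qed.

(** All f i are multiples of f 0 by roots of X^N - 1, of which there are at most N. *)
Lemma tame_fiber n (f : 'I_N.+1 -> {poly K}) :
  (forall i, tame (f i)) -> (forall i, degval (f i) = n) ->
  exists i j, i != j /\ f i = f j.
Proof.
move=> tf fn.
have ratio i : exists w, w ^+ N = 1 /\ f i = w *: f ord0.
  have [|w sw fw] := tame_ratio (tf i) (tf ord0).
    by apply: tame_deg_inj => //; rewrite !fn.
  by exists w; have [] := symmetry_order sw.
have [w wP] := choice ratio.
have [/injectiveP winj|/injectivePn[i [j ij wij]]] := boolP (injectiveb w); last first.
  by exists i, j; split=> //; rewrite (wP i).2 (wP j).2 wij.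
suff : (size (codom w) < size ('X^N - 1 : {poly K})%R)%N.
  by rewrite size_Xn_sub_1 // size_codom card_ord ltnn.
apply: max_poly_roots.
- by rewrite -size_poly_eq0 size_Xn_sub_1.
- by apply/allP => _ /codomP[i ->]; rewrite /root hornerD hornerN hornerXn hornerC (wP i).1 subrr.
- exact/injectiveP.
Qed.

End CommutingFamily.

(** * Banach limits *)

Section BanachLimit.
Variable R : realType.
Implicit Types u v : nat -> R.

Definition bounded_seq u := exists B, forall n, `|u n| <= B.

Definition cesaro u n : R := n.+1%:R^-1 * \sum_(k < n.+1) u k.

Lemma cesaro_bounded u B : (forall n, `|u n| <= B) -> forall n, `|cesaro u n| <= B.
Proof.
move=> uB n; rewrite /cesaro normrM normfV normr_nat ler_pdivrMl //.
apply: le_trans (ler_norm_sum _ _ _) _; rewrite mulrC mulr_natr.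
rewrite -[leRHS](_ : \sum_(k < n.+1) B = _) ?ler_sum //.
by rewrite sumr_const card_ord.
Qed.

(** The image filter clusters in the compact [-B, B], and an ultrafilter converges to its cluster
    points. *)
Lemma ultrafilter_cvg (U : set_system nat) u : UltraFilter U -> bounded_seq u ->
  exists l : R, u @ U --> l.
Proof.
move=> UU [B uB]; have PU := @ultra_proper _ _ UU.
have [|l [_ lU]] := @segment_compact R (- B) B (u @ U) (fmap_proper_filter u PU).
  by apply: (filterE (F := U)) => n /=; rewrite in_itv /= -ler_norml.
exists l => V lV /=; have [//|nV] := in_ultra_setVsetC (u @^-1` V) UU.
have [|x [? ?]] := lU (~` V) V _ lV; first exact: nV.
by [].
Qed.

(** L is the limit of Cesaro means along an ultrafilter finer than the filter at infinity. *)
Lemma banach_limit : exists L : (nat -> R) -> R,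
  [/\ forall a u v, bounded_seq u -> bounded_seq v ->
        L (fun n => a * u n + v n) = a * L u + L v,
      forall u, bounded_seq u -> (forall n, 0 <= u n) -> 0 <= L u,
      L (fun=> 1) = 1 &
      forall u, bounded_seq u -> L (fun n => u n.+1) = L u].
Proof.
have [U [UU ooU]] := @ultraFilterLemma _ (\oo : set_system nat) _.
have PU := @ultra_proper _ _ UU.
pose L u : R := lim (cesaro u @ U).
have cL u : bounded_seq u -> cesaro u @ U --> L u.
  move=> [B uB]; apply/cvg_ex; apply: ultrafilter_cvg => //.
  by exists B; exact: cesaro_bounded.
have LE u l : cesaro u @ U --> l -> L u = l by exact: cvg_lim.
exists L; split=> [a u v bu bv|u bu u0||u [B uB]].
- apply: LE; rewrite (_ : cesaro _ = (fun n => a * cesaro u n + cesaro v n)).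
    by apply: cvgD; [apply: cvgM; [exact: cvg_cst|exact: cL]|exact: cL].
  apply/funext => n; rewrite /cesaro big_split /= mulrDr -mulr_sumr; congr (_ + _).
  by rewrite mulrCA.
- apply: (@limr_ge _ _ _ _ 0 (cesaro u)); first exact: (cvgP _ (cL _ bu)).
  by apply: nearW => n; rewrite mulr_ge0 // ?invr_ge0 // sumr_ge0.
- apply: LE; rewrite (_ : cesaro _ = fun=> 1); first exact: cvg_cst.
  by apply/funext => n; rewrite /cesaro sumr_const card_ord mulVf.
(* Shifting u changes its Cesaro means by a telescoped term of size at most 2B/(n + 1). *)
- apply: LE; rewrite (_ : cesaro _ = fun n => cesaro u n + (u n.+1 - u 0%N) * n.+1%:R^-1).
    rewrite -[L u]addr0; apply: cvgD; first by apply: cL; exists B.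
    suff : (fun n => (u n.+1 - u 0%N) * n.+1%:R^-1) @ \oo --> (0 : R).
      by move=> h V hV; apply: ooU; exact: h.
    apply: (@squeeze_cvgr _ _ _ _ (fun n => - (2 * B * n.+1%:R^-1)) (fun n => 2 * B * n.+1%:R^-1)).
    + apply: nearW => n; rewrite -ler_norml normrM [X in _ * X]ger0_norm ?invr_ge0 //.
      rewrite ler_wpM2r ?invr_ge0 //; apply: le_trans (ler_normB _ _) _.
      by rewrite mulrDl mul1r lerD.
    + rewrite -oppr0 -(mulr0 (2 * B)); apply: cvgN; apply: cvgM; first exact: cvg_cst.
      exact: cvg_harmonic.
    + rewrite -(mulr0 (2 * B)); apply: cvgM; first exact: cvg_cst.
      exact: cvg_harmonic.
  apply/funext => n; rewrite /cesaro [X in _ * X]big_ord_recr /= [in RHS]big_ord_recl /=.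
  ring.
Qed.

End BanachLimit.

(** * Complex-valued Banach limits *)

Section ComplexBanachLimit.
Variable R : realType.
Local Notation Re := (@complex.Re R).
Local Notation Im := (@complex.Im R).
Local Notation normc := (@Normc.normc R).

Lemma Re_le_normc (x : R[i]) : `|Re x| <= normc x.
Proof. by have := normc_ge_Re x; rewrite -[leRHS]/((normc x)%:C%C) lecR. Qed.

Lemma Im_le_normc (x : R[i]) : `|Im x| <= normc x.
Proof.
have := Re_le_normc (x * 'i%C); rewrite ReiNIm normrN => /le_trans; apply.
by rewrite Normc.normcM [normc 'i%C](_ : _ = 1) ?mulr1 //= expr0n expr1n add0r sqrtr1.
Qed.

Lemma complex_banach_limit : exists L : (nat -> R[i]) -> R[i],
  [/\ forall (a : R[i]) u v (B C : R), (forall n, normc (u n) <= B) ->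
        (forall n, normc (v n) <= C) ->
        L (fun n => a * u n + v n) = a * L u + L v,
      forall u (B : R), (forall n, normc (u n) <= B) -> normc (L u) <= B,
      forall u (B : R), (forall n, normc (u n) <= B) -> (forall n, 0 <= u n) -> 0 <= L u,
      L (fun=> 1) = 1 &
      forall u (B : R), (forall n, normc (u n) <= B) -> L (fun n => u n.+1) = L u].
Proof.
have [L [Llin Lpos L1 Lshift]] := @banach_limit R.
pose Lc (u : nat -> R[i]) := (L (Re \o u) +i* L (Im \o u))%C.
have L0 : L (fun=> 0) = 0.
  have b0 : @bounded_seq R (fun=> 0) by exists 0 => n; rewrite normr0.
  have := Llin (-1) _ _ b0 b0; rewrite (mulN1r (L _)) addNr => e; rewrite -[RHS]e.
  by congr L; apply/funext => n; rewrite mulr0 addr0.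
have bRe u (B : R) : (forall n, normc (u n) <= B) -> bounded_seq (Re \o u).
  by move=> uB; exists B => n; apply: le_trans (Re_le_normc _) (uB n).
have bIm u (B : R) : (forall n, normc (u n) <= B) -> bounded_seq (Im \o u).
  by move=> uB; exists B => n; apply: le_trans (Im_le_normc _) (uB n).
have bD u v (a : R) : bounded_seq u -> bounded_seq v ->
    bounded_seq (fun n => a * u n + v n).
  move=> [B uB] [C vC]; exists (`|a| * B + C) => n.
  by apply: le_trans (ler_normD _ _) _; rewrite normrM lerD // ler_wpM2l.
have Lclin (a : R[i]) u v (B C : R) : (forall n, normc (u n) <= B) ->
    (forall n, normc (v n) <= C) ->
    Lc (fun n => a * u n + v n) = a * Lc u + Lc v.
  case: a => a b uB vC; have [ru iu] := (bRe _ _ uB, bIm _ _ uB).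
  have [rv iv] := (bRe _ _ vC, bIm _ _ vC).
  transitivity ((a * L (Re \o u) + (- b * L (Im \o u) + L (Re \o v))) +i*
                (a * L (Im \o u) + (b * L (Re \o u) + L (Im \o v))))%C.
    rewrite -!Llin //; try exact: bD.
    by rewrite /Lc; congr (L _ +i* L _)%C; apply/funext => n /=;
      case: (u n) (v n) => [x y] [x' y'] /=; ring.
  by rewrite /Lc; apply/eqP; rewrite eq_complex /=; apply/andP; split; apply/eqP; ring.
(* Rotation trick: multiplying u by the conjugate of [Lc u] makes the limit the real number r^2,
   which positivity of L bounds by rB. *)
have Lcle u (B : R) : (forall n, normc (u n) <= B) -> normc (Lc u) <= B.
  move=> uB; set r := normc (Lc u); have r0 : 0 <= r by exact: normc_ge0.
  have B0 : 0 <= B := le_trans (normc_ge0 _) (uB 0%N).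
  have [->//|rn0] := eqVneq r 0.
  have rp : 0 < r by rewrite lt_neqAle eq_sym rn0.
  have rJ : normc (Lc u)^*%C = r.
    by apply: complexI; have := normcJ (Lc u).
  rewrite -(ler_pM2l rp).
  have -> : r * r = L (fun n => Re ((Lc u)^*%C * u n)).
    have := Lclin (Lc u)^*%C u (fun=> 0) B 0 uB (fun=> _).
    rewrite Normc.normc0 lexx => /(_ (fun=> isT)) /(congr1 Re).
    have -> : Lc (fun=> 0) = 0 by rewrite /Lc L0.
    rewrite addr0 mulrC -sqr_normc => e.
    transitivity (Re (`|Lc u| ^+ 2)).
      by rewrite -[`|Lc u|]/(r%:C%C) -rmorphXn /= expr2.
    by rewrite -e /Lc /=; congr L; apply/funext => n /=; rewrite addr0.
  have bu : bounded_seq (fun n => Re ((Lc u)^*%C * u n)).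
    by exists (r * B) => n; apply: le_trans (Re_le_normc _) _; rewrite Normc.normcM rJ ler_wpM2l.
  have b1 : @bounded_seq R (fun=> 1) by exists 1 => n; rewrite normr1.
  have b0 : @bounded_seq R (fun=> 0) by exists 0 => n; rewrite normr0.
  have bs : bounded_seq (fun n => r * B * 1 + 0) by exact: (bD _ _ (r * B) b1 b0).
  have e : L (fun n => -1 * Re ((Lc u)^*%C * u n) + (r * B * 1 + 0)) =
      r * B - L (fun n => Re ((Lc u)^*%C * u n)).
    by rewrite (Llin (-1) _ _ bu bs) (Llin (r * B) _ _ b1 b0) L1 L0; ring.
  rewrite -subr_ge0 -e; apply: Lpos; first exact: (bD _ _ (-1) bu bs).
  move=> n; rewrite mulN1r mulr1 addr0 addrC subr_ge0.
  apply: le_trans (ler_norm _) _; apply: le_trans (Re_le_normc _) _.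
  by rewrite Normc.normcM rJ ler_wpM2l.
exists Lc; split=> //.
- move=> u B uB u0; rewrite /Lc (_ : Im \o u = fun=> 0) ?L0; last first.
    by apply/funext => n /=; exact: ger0_Im.
  rewrite lecE /= eqxx /=; apply: Lpos; first exact: bRe uB.
  by move=> n /=; have := u0 n; rewrite lecE => /andP[].
- by rewrite /Lc (_ : Im \o _ = fun=> 0) ?L0 // (_ : Re \o _ = fun=> 1) ?L1.
- move=> u B uB; rewrite /Lc -(Lshift _ (bRe _ _ uB)) -(Lshift _ (bIm _ _ uB)).
  by [].
Qed.

End ComplexBanachLimit.

(** * Invariant means on a semigroup with a large centre *)

Section CentralElement.
Variables (S : semigroupType) (z : S).
Hypothesis zC : forall x, (z * x = x * z)%g.
Hypothesis mulIl : forall a x y : S, (a * x = a * y)%g -> x = y.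
Hypothesis mulIr : forall a x y : S, (x * a = y * a)%g -> x = y.

(** Written as an action because S need not have a unit: n = 0 must be allowed. *)
Definition shift n (x : S) : S := iter n (fun y => y * z)%g x.

Lemma shiftD m n x : shift (m + n) x = shift m (shift n x).
Proof. exact: iterD. Qed.

Lemma shiftC m n x : shift m (shift n x) = shift n (shift m x).
Proof. by rewrite -!shiftD addnC. Qed.

Lemma shift_mull n x y : (x * shift n y)%g = shift n (x * y)%g.
Proof. by elim: n => //= n <-; rewrite mulgA. Qed.

Lemma shift_mulr n x y : (shift n x * y)%g = shift n (x * y)%g.
Proof. by elim: n => //= n <-; rewrite -mulgA zC mulgA. Qed.

Lemma shift_inj n : injective (shift n).
Proof. by elim: n => // n IH x y /mulIr/IH. Qed.

Definition zequiv (x y : S) := exists m n, shift m x = shift n y.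

Lemma zequiv_refl x : zequiv x x. Proof. by exists 0%N, 0%N. Qed.

Lemma zequiv_sym x y : zequiv x y -> zequiv y x.
Proof. by move=> [m [n e]]; exists n, m. Qed.

Lemma zequiv_trans y x t : zequiv x y -> zequiv y t -> zequiv x t.
Proof.
move=> [m [n e]] [p [q f]]; exists (p + m)%N, (n + q)%N.
by rewrite shiftD e -shiftD addnC shiftD f shiftD.
Qed.

Lemma zequiv_mull a x y : zequiv (a * x)%g (a * y)%g <-> zequiv x y.
Proof.
split=> -[m [n e]]; exists m, n; last by rewrite -!shift_mull e.
by move: e; rewrite -!shift_mull => /mulIl.
Qed.

Lemma zequiv_mulr a x y : zequiv (x * a)%g (y * a)%g <-> zequiv x y.
Proof.
split=> -[m [n e]]; exists m, n; last by rewrite -!shift_mulr e.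
by move: e; rewrite -!shift_mulr => /mulIr.
Qed.

Lemma zequiv_shift n x : zequiv (shift n x) x.
Proof. by exists 0%N, n. Qed.

Variables (g : nat) (rep : 'I_g -> S) (cls : S -> 'I_g).
Hypothesis cls_rep : forall x, zequiv x (rep (cls x)).
Hypothesis rep_inj : forall i j, zequiv (rep i) (rep j) -> i = j.

Lemma clsP x y : cls x = cls y <-> zequiv x y.
Proof.
split=> [e|xy]; first by apply: zequiv_trans (cls_rep x) _; rewrite e; exact/zequiv_sym/cls_rep.
apply: rep_inj; apply: zequiv_trans (zequiv_sym (cls_rep x)) _.
exact: zequiv_trans xy (cls_rep y).
Qed.

Lemma cls_repK : cancel rep cls.
Proof. by move=> i; apply/rep_inj/zequiv_sym/cls_rep. Qed.

Lemma cls_mull_inj s : injective (fun i => cls (s * rep i)%g).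
Proof. by move=> i j /clsP/zequiv_mull/rep_inj. Qed.

Lemma cls_mulr_inj s : injective (fun i => cls (rep i * s)%g).
Proof. by move=> i j /clsP/zequiv_mulr/rep_inj. Qed.

(** Left multiplication by x_i permutes the finitely many classes, so some representative t
    satisfies x_i t ~ s x_i. Centrality of z carries this relation, with the same a and b, to the
    whole class of x_i. *)
Lemma left_as_right s i : exists t a b, forall x, cls x = i ->
  shift b (s * x)%g = (x * shift a t)%g.
Proof.
have [j ij] : exists j, cls (rep i * rep j)%g = cls (s * rep i)%g.
  have [f _ fK] := injF_bij (@cls_mull_inj (rep i)).
  by exists (f (cls (s * rep i)%g)); rewrite [LHS]fK.
have /clsP[a [b e]] := ij; exists (rep j), a, b => x xi.
have /clsP[m [n xr]] : cls x = cls (rep i) by rewrite xi cls_repK.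
apply: (@shift_inj m); rewrite [LHS]shiftC -[in LHS]shift_mull xr shift_mull.
by rewrite [LHS]shiftC -e [LHS]shiftC -[in LHS]shift_mulr -xr shift_mulr shift_mull [LHS]shiftC.
Qed.

Variable R : realType.
Local Notation Linf := (Linf R S).

Lemma Linf_eqP (phi psi : Linf) : (forall x, phi x = psi x) -> phi = psi.
Proof. by move=> e; apply/val_inj/funext. Qed.

Lemma bounded_restrict i (phi : Linf) :
  (fun x => if cls x == i then phi x else 0) \in @bounded_pred R S.
Proof.
have /bounded_predP[B phiB] := valP phi; apply/bounded_predP; exists B => x.
case: ifP => _; first exact: phiB.
rewrite -[leLHS]/(Normc.normc (0 : R[i])) Normc.normc0.
exact: le_trans (normc_ge0 _) (phiB x).
Qed.

Definition Linf_restrict i (phi : Linf) : Linf := MkLinf (bounded_restrict i phi).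

Lemma Linf_sumE n (phi : 'I_n -> Linf) x : (\sum_i phi i) x = \sum_i phi i x.
Proof. by apply: (big_morph (fun f : Linf => f x)). Qed.

Lemma sum_Linf_restrict (phi : Linf) : phi = \sum_i Linf_restrict i phi.
Proof.
apply: Linf_eqP => x; rewrite Linf_sumE (bigD1 (cls x)) //= eqxx big1 ?addr0 // => i.
by rewrite eq_sym => /negbTE ->.
Qed.

Section RightInvariant.
Variable M : {linear Linf -> R[i]^o}.
Hypothesis Mr : forall s phi, M (rtrans s phi) = M phi.

Lemma mean_shift n phi : M (Linf_reindex (shift n) phi) = M phi.
Proof.
elim: n phi => [|n IH] phi; first by congr (M _); apply: Linf_eqP.
by rewrite -[RHS](Mr z) -[RHS]IH; congr (M _); apply: Linf_eqP.
Qed.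

(* On the class of x_i, left translation by s agrees, up to powers of z, with the
   right translation by some t: a right invariant mean cannot tell them apart. *)
Lemma right_invariant_left s phi : M (ltrans s phi) = M phi.
Proof.
rewrite (sum_Linf_restrict (ltrans s phi)) [in RHS](sum_Linf_restrict phi) !linear_sum.
rewrite [RHS](reindex _ (onW_bij _ (injF_bij (@cls_mull_inj s)))) /=.
apply: eq_bigr => i _; have [t [a [b st]]] := left_as_right s i.
rewrite -(mean_shift b) -[RHS](Mr (shift a t)); congr (M _); apply: Linf_eqP => x /=.
have shiftC : cls (shift b x) = cls x by apply/clsP; exact: zequiv_shift.
rewrite shiftC shift_mull.
(* Right translation by [shift a t] sends class i, and no other class, into the class of
   [s * rep i], so the restrictions match. *)
have -> : (cls (x * shift a t)%g == cls (s * rep i)%g) = (cls x == i); last first.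
  by case: eqP => // /st ->.
have e y : cls y = i -> cls (y * shift a t)%g = cls (s * rep i)%g.
  move=> yi; rewrite -(st y yi); apply/clsP; apply: zequiv_trans (zequiv_shift _ _) _.
  by apply/zequiv_mull/clsP; rewrite cls_repK.
apply/eqP/eqP => [|/e //]; rewrite -(e _ (cls_repK i)) => /clsP/zequiv_mulr/clsP ->.
exact: cls_repK.
Qed.

End RightInvariant.

(* The mean averages phi over the classes, taking a Banach limit along each
   orbit x_i, x_i z, x_i z^2, ... *)
Lemma exists_right_invariant_mean :
  exists M : {linear Linf -> R[i]^o}, RIM R S M.
Proof.
have [L [Llin Lle Lpos L1 Lshift]] := complex_banach_limit R.
have orbB (phi : Linf) (x : S) n : Normc.normc (phi (shift n x)) <= sup_norm phi.
  exact: le_sup_norm.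
have g0 : (g%:R : R[i]) != 0.
  by rewrite pnatr_eq0 -lt0n (leq_ltn_trans _ (ltn_ord (cls z))).
pose m (phi : Linf) : R[i]^o :=
  g%:R^-1 * \sum_(i < g) L (fun n => phi (shift n (rep i))).
have mlin : linear m.
  move=> a phi psi; rewrite -[X in _ = X + _]/(a * m phi) /m mulrCA -mulrDr; congr (_ * _).
  rewrite mulr_sumr -big_split /=; apply: eq_bigr => i _.
  by rewrite -(Llin _ _ _ _ _ (orbB phi _) (orbB psi _)).
pose M : {linear Linf -> R[i]^o} := HB.pack m (GRing.isLinear.Build _ _ _ _ m mlin).
have M1 : M (Linf_one R S) = 1.
  rewrite -[LHS]/(m _) /m /= L1 sumr_const card_ord mulVf //.
have Mle (phi : Linf) : Normc.normc (M phi) <= sup_norm phi.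
  rewrite -lecR -[X in X <= _]/(`|m phi : R[i]|) /m normrM normfV normr_nat.
  rewrite ler_pdivrMl; last by rewrite lt_neqAle eq_sym g0 ler0n.
  apply: le_trans (ler_norm_sum _ _ _) _.
  rewrite mulr_natl -[leRHS](_ : \sum_(i < g) (sup_norm phi)%:C%C = _); last first.
    by rewrite sumr_const card_ord.
  apply: ler_sum => i _; rewrite -[leLHS]/((Normc.normc _)%:C%C) lecR.
  exact: Lle (orbB phi _).
exists M; split; last first.
  move=> s phi; rewrite -[LHS]/(m _) -[RHS]/(m _) /m; congr (_ * _).
  rewrite [RHS](reindex _ (onW_bij _ (injF_bij (@cls_mulr_inj s)))) /=.
  apply: eq_bigr => i _.
  have /zequiv_sym[a [b e]] := cls_rep (rep i * s)%g.
  (* By [e] the orbits of [rep i * s] and of its representative merge after b and a steps, and L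
     ignores finitely many steps. *)
  have Lshiftn k (psi : Linf) x : L (fun n => psi (shift (n + k) x)) = L (fun n => psi (shift n x)).
    elim: k => [|k IH]; first by congr L; apply/funext => n; rewrite addn0.
    rewrite -IH -[RHS](Lshift _ (sup_norm psi)); last by move=> n; exact: orbB.
    by congr L; apply/funext => n; rewrite addSnnS.
  rewrite -(Lshiftn a) -[LHS](_ : L (fun n => phi (shift (n + b) (rep i * s)%g)) = _).
    by congr L; apply/funext => n; rewrite !shiftD e.
  rewrite Lshiftn; congr L; apply/funext => n /=.
  by rewrite shift_mulr.
split.
- apply: bounded_linear_continuous; apply/bounded_funP => r; exists r => phi phir.
  apply: le_trans phir; rewrite -[leLHS]/((Normc.normc (M phi))%:C%C).
  by rewrite -[leRHS]/((sup_norm phi)%:C%C) lecR.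
- move=> phi phi0; rewrite -[M phi]/(m phi) /m mulr_ge0 ?invr_ge0 ?ler0n //.
  by apply: sumr_ge0 => i _; apply: (Lpos _ _ (orbB phi _)) => n; exact: phi0.
- apply/eqP; rewrite /op_norm eq_le; apply/andP; split.
    apply: ge_sup.
      exists (Normc.normc (M (Linf_one R S))), (Linf_one R S) => //=.
      rewrite -[leLHS]/((sup_norm _)%:C%C) -[leRHS]/(1%:C%C) lecR.
      by apply: sup_norm_le => // x; rewrite Normc.normc1.
    move=> _ [phi /= phi1 <-]; apply: le_trans (Mle phi) _.
    by move: phi1; rewrite -[leLHS]/((sup_norm _)%:C%C) -[leRHS]/(1%:C%C) lecR.
  apply: ub_le_sup.
    exists 1 => _ [phi /= phi1 <-]; apply: le_trans (Mle phi) _.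
    by move: phi1; rewrite -[leLHS]/((sup_norm _)%:C%C) -[leRHS]/(1%:C%C) lecR.
  exists (Linf_one R S); last by rewrite M1 Normc.normc1.
  move=> /=.
  rewrite -[leLHS]/((sup_norm _)%:C%C) -[leRHS]/(1%:C%C) lecR.
  by apply: sup_norm_le => // x; rewrite Normc.normc1.
- exact: M1.
Qed.

End CentralElement.

(** * Finiteness of the set of classes *)

Section FiniteClasses.
Variables (S : semigroupType) (z : S).
Local Notation zequiv := (zequiv z).

Definition finitely_many_classes := exists g (rep : 'I_g -> S) (cls : S -> 'I_g),
  (forall x, zequiv x (rep (cls x))) /\
  (forall i j, zequiv (rep i) (rep j) -> i = j).

(** A family of pairwise inequivalent elements of maximal length meets every class. *)
Lemma finite_classes_of_bound B :
  (forall n (f : 'I_n -> S), (forall i j, zequiv (f i) (f j) -> i = j) -> (n <= B)%N) ->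
  finitely_many_classes.
Proof.
move=> fB; pose P n := `[< exists f : 'I_n -> S, forall i j, zequiv (f i) (f j) -> i = j >].
have P0 : exists n, P n.
  by exists 0%N; apply/asboolP; exists (fun=> z) => -[].
have PB n : P n -> (n <= B)%N by move=> /asboolP[f /fB].
have [g /asboolP[rep rep_inj] gmax] := ex_maxnP P0 PB.
have classified x : exists i, zequiv x (rep i).
  apply: contrapT => /forallNP xrep; suff /gmax : P g.+1 by rewrite ltnn.
  apply/asboolP; exists (fun i => if unlift ord0 i is Some j then rep j else x) => i j.
  case: unliftP => [i'|] ->; case: unliftP => [j'|] -> //.
  - by move=> /rep_inj ->.
  - by move=> /zequiv_sym/xrep.
  - by move=> /xrep.
have [cls clsP] := choice classified.
by exists g, rep, cls.
Qed.

Variables (alpha : S -> nat) (N : nat).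
Hypothesis alphaM : forall x y, alpha (x * y)%g = (alpha x + alpha y)%N.
Hypothesis alpha_z : (0 < alpha z)%N.
Hypothesis fiber : forall n (f : 'I_N.+1 -> S), (forall i, alpha (f i) = n) ->
  exists i j, i != j /\ f i = f j.

Lemma alpha_shift n x : alpha (shift z n x) = (alpha x + n * alpha z)%N.
Proof. by elim: n => [|n IH]; rewrite ?addn0 //= alphaM IH; lia. Qed.

(** Among more than N alpha(z) inequivalent elements, N + 1 agree modulo alpha(z). Powers of z bring
    these to one value of alpha, where two must coincide, making two of the elements equivalent. *)
Lemma finite_classes_of_fibers : finitely_many_classes.
Proof.
apply: (@finite_classes_of_bound (alpha z * N)) => n f finj.
pose h (i : 'I_n) : 'I_(alpha z) := Ordinal (ltn_pmod (alpha (f i)) alpha_z).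
rewrite leqNgt; apply/negP => big.
have [r rN] : exists r, (N < #|[pred i | h i == r]|)%N.
  apply: contrapT => /forallNP small; move: big; apply/negP; rewrite -leqNgt.
  rewrite -[n in (n <= _)%N]card_ord -sum1_card (partition_big h predT) //=.
  rewrite -[(alpha z * N)%N]/((alpha z) * N)%N -[alpha z in leqRHS]card_ord -sum_nat_const.
  by apply: leq_sum => r _; rewrite sum1_card leqNgt; apply/negP/small.
pose e (i : 'I_N.+1) : 'I_n := enum_val (widen_ord rN i).
have eh i : (alpha (f (e i)) %% alpha z)%N = r.
  by have := enum_valP (widen_ord rN i); rewrite inE => /eqP/(congr1 val).
pose q i := (alpha (f (e i)) %/ alpha z)%N.
(* The sum of the quotients is just a common upper bound for them, so that each subtraction is
   exact. *)
have [|i [j [ij]]] := @fiber ((\sum_i q i) * alpha z + r)%N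
    (fun i => shift z (\sum_i q i - q i) (f (e i))).
  move=> i; rewrite alpha_shift (divn_eq (alpha (f (e i))) (alpha z)) eh -/(q i).
  have : (q i <= \sum_i q i)%N by rewrite (bigD1 i) //= leq_addr.
  by move=> /subnK {2}<-; rewrite mulnDl; lia.
move=> fij; move: ij; apply/negP; rewrite negbK; apply/eqP.
have : e i = e j by apply: finj; exists (\sum_i q i - q i)%N, (\sum_i q i - q j)%N.
by move=> /enum_val_inj/(congr1 val) ij; apply: val_inj.
Qed.

End FiniteClasses.

Lemma amenable_of_central (R : realType) (S : semigroupType) (z : S) :
  (forall x, (z * x = x * z)%g) ->
  (forall a x y : S, (a * x = a * y)%g -> x = y) ->
  (forall a x y : S, (x * a = y * a)%g -> x = y) ->
  finitely_many_classes z ->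
  amenable R S /\ RIM R S `<=` LIM R S.
Proof.
move=> zC mulIl mulIr [g [rep [cls [cls_rep rep_inj]]]].
have RL : RIM R S `<=` LIM R S.
  move=> M [meanM Mr]; split=> // s phi.
  exact: (right_invariant_left zC mulIl mulIr cls_rep rep_inj Mr).
have [M MR] := exists_right_invariant_mean zC mulIr cls_rep rep_inj R.
by split=> //; exists M; split=> //; exact: RL.
Qed.

(** * Generated semigroups *)

Section Recentering.
Variable K : fieldType.
Implicit Types P Q : {poly K}.

Definition recenter (c : K) P := (P \Po ('X + c%:P)) - c%:P.

Lemma recenter_comp c P Q : recenter c (P \Po Q) = recenter c P \Po recenter c Q.
Proof.
rewrite /recenter comp_polyB comp_polyC -!comp_polyA comp_polyD comp_polyX.
by rewrite comp_polyC subrK.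
Qed.

Lemma recenter_iter c n P : recenter c (poly_iter n P) = poly_iter n (recenter c P).
Proof.
elim: n => [|n IH]; first by rewrite /recenter comp_polyX addrK.
by rewrite recenter_comp IH.
Qed.

Lemma recenterK c : cancel (recenter c) (recenter (- c)).
Proof.
move=> P; rewrite /recenter comp_polyB comp_polyC -comp_polyA comp_polyD comp_polyX.
by rewrite comp_polyC polyCN addrNK comp_polyXr opprK subrK.
Qed.

Lemma deg_recenter c P : deg (recenter c P) = deg P.
Proof.
have degC Q (a : K) : deg (Q - a%:P) = deg Q.
  rewrite /deg; have [Q1|Q1] := leqP (size Q) 1.
    rewrite (size1_polyC Q1) -polyCB !size_polyC; by do 2 case: eqP.
  by rewrite size_polyDl // size_polyN (leq_ltn_trans (size_polyC_leq1 _)).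
rewrite degC deg_comp [X in (_ * X)%N](_ : _ = 1%N) ?muln1 //.
by rewrite /deg size_XaddC.
Qed.

Lemma size_recenter c P : (1 < size P)%N -> size (recenter c P) = size P.
Proof. by have := deg_recenter c P; rewrite /deg; lia. Qed.

(** With d = deg P, the coefficient of P(X + c) in degree d - 1 is P_(d-1) + d c P_d, which is
    solved for c; subtracting the constant c does not affect it as d > 1. *)
Lemma centered_recenter P : [pchar K] =i pred0 -> (2 < size P)%N ->
  exists c, centered (recenter c P).
Proof.
move=> K0 sP; have lP := coef_deg_neq0 (ltnW sP).
have n0 : (deg P)%:R != 0 :> K by rewrite ((pcharf0P K).1 K0) /deg; lia.
exists (- P`_(deg P).-1 / (P`_(deg P) *+ deg P)).
set c := _ / _; rewrite /centered size_recenter; last exact: ltnW.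
rewrite -/(deg P) /recenter coefB coefC ifN ?subr0; last by rewrite /deg; lia.
have := comp_polyB_quotient P ('X + c%:P) 'X.
rewrite comp_polyXr addrAC subrr add0r => /eqP; rewrite subr_eq => /eqP ->.
rewrite coefD coefCM.
have := @coef_comp_quotient K 1 (deg P) P ('X + c%:P) 'X.
rewrite muln1 => ->; rewrite ?size_XaddC ?size_polyX //; try by rewrite /deg; lia.
  rewrite coefD coefX coefC /= addr0 expr1n mulr1 /c divfK ?addNr //.
  by rewrite -mulr_natr mulf_neq0.
by rewrite !coefD !coefX !coefC /= addr0.
Qed.

End Recentering.

(* t X^d is conjugate to X^d by the scaling a X with a^(d - 1) = t. *)
Lemma recenter_monomial_exceptional (K : fieldType) (c : K) (P : {poly K}) :
  (forall n (x : K), (0 < n)%N -> exists a, a ^+ n = x) ->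
  (2 < size P)%N -> (forall i, (i < deg P)%N -> (recenter c P)`_i = 0) ->
  exceptional P.
Proof.
move=> roots sP mono; have d1 : (1 < deg P)%N by rewrite /deg; lia.
set t := (recenter c P)`_(deg P).
have TE : recenter c P = t *: 'X^(deg P).
  apply/polyP => i; rewrite coefZ coefXn.
  have [id|di|->] := ltngtP i (deg P); last by rewrite mulr1.
    by rewrite mono // mulr0n mulr0.
  rewrite mulr0n mulr0 nth_default // size_recenter; last by lia.
  by move: di; rewrite /deg; lia.
have t0 : t != 0.
  have := coef_deg_neq0 (_ : 1 < size (recenter c P))%N.
  by rewrite deg_recenter size_recenter; [apply|]; exact: ltnW.
have [|a at_] := roots (deg P).-1 t; first by lia.
have a0 : a != 0.
  by apply: contra_neq t0 => a0; rewrite -at_ a0 expr0n; case: (_ == _) / eqP => //; lia.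
right; exists (deg P); first by lia.
(* The conjugating map is a(X - c): undo the recentering, then scale. *)
apply: Or31; exists a, (- (a * c)); split=> //.
rewrite -[LHS](recenterK c) TE /recenter !comp_polyZ !comp_polyB !comp_polyX !comp_polyC.
rewrite !comp_Xn_poly.
have -> : a *: 'X + (- (a * c))%:P = a *: ('X + (- c)%:P).
  by rewrite scalerDr -mul_polyC -[a *: (- c)%:P]mul_polyC -polyCM mulrN.
rewrite exprZn scalerBr scalerA -[in a ^+ deg P](prednK (ltnW d1)) exprS mulrA mulVf // mul1r.
rewrite at_; congr (_ - _).
by rewrite -mul_polyC -polyCM mulrN mulrA mulVf ?mul1r.
Qed.

(** * The semigroup generated by the family *)

Section GeneratedSemigroup.
Variable (R : realType) (F : set {poly R[i]}).

Lemma compositions_iter P n : (0 < n)%N -> F P -> compositions F (poly_iter n P).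
Proof.
move=> n0 FP; exists (nseq n P); split.
- by case: n n0.
- by move=> Q; rewrite mem_nseq => /andP[_ /eqP ->].
- by elim: n {n0} => //= n ->.
Qed.

Lemma compositions_ind (p : {poly R[i]} -> Prop) :
  (forall P, F P -> p P) -> (forall P Q, p P -> p Q -> p (P \Po Q)) ->
  forall P, compositions F P -> p P.
Proof.
move=> pF pcomp P [s [s0 Fs ->]]; elim: s s0 Fs => // A [|B s] IH _ Fs /=.
  by rewrite comp_polyXr; apply/pF/Fs; rewrite mem_head.
apply: pcomp; first by apply/pF/Fs; rewrite mem_head.
by apply: IH => // Q Qs; apply: Fs; rewrite inE Qs orbT.
Qed.

(* Constants are not exceptional here, so a family reduced to one constant has to
   be treated apart. *)
Lemma amenable_constant P0 : F P0 -> (size P0 <= 1)%N ->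
  (forall P Q, F P -> F Q -> share_iterate P Q) ->
  amenable R (generated_semigroup F) /\
  RIM R (generated_semigroup F) `<=` LIM R (generated_semigroup F).
Proof.
move=> FP0 sP0 FF.
have iter_const n (P : {poly R[i]}) : (0 < n)%N -> (size P <= 1)%N -> poly_iter n P = P.
  by case: n => // n _ /size1_polyC ->; rewrite /= comp_polyC.
have F1 Q : F Q -> Q = P0.
  move=> FQ; have [m [n [m0 n0]]] := FF _ _ FP0 FQ; rewrite iter_const // => e.
  have Q1 : (size Q <= 1)%N.
    have := congr1 (@deg _) e; rewrite deg_iter /deg.
    have -> : (size P0).-1 = 0%N by move: sP0; case: (size P0) => [|[]].
    by move=> /esym/eqP; rewrite expn_eq0 n0 andbT; case: (size Q) => [|[]].
  by rewrite e iter_const.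
have S1 Q : compositions F Q -> Q = P0.
  apply: (@compositions_ind (fun P => P = P0)) => // P' Q' -> ->.
  by rewrite (size1_polyC sP0) comp_polyC.
have S1' (x y : generated_semigroup F) : x = y.
  by apply: val_inj; rewrite (S1 _ (set_valP x)) (S1 _ (set_valP y)).
pose z : generated_semigroup F := SigSub (mem_set (compositions_iter (isT : 0 < 1)%N FP0)).
apply: (amenable_of_central R (z := z)) => //.
exists 1%N, (fun=> z), (fun=> ord0); split=> [x|i j _]; last by rewrite !ord1.
by rewrite (S1' x z); exact: zequiv_refl.
Qed.

Lemma amenable_nonexceptional P0 : F P0 -> (2 < size P0)%N -> ~ exceptional P0 ->
  (forall P Q, F P -> F Q -> share_iterate P Q) ->
  amenable R (generated_semigroup F) /\
  RIM R (generated_semigroup F) `<=` LIM R (generated_semigroup F).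
Proof.
move=> FP0 sP0 nexc FF.
have K0 : [pchar R[i]] =i pred0 by exact: pchar_num.
have [c cT] := centered_recenter K0 sP0.
set T := recenter c P0 in cT.
have sT : (2 < size T)%N by rewrite size_recenter // ltnW.
(* T is not a monomial, as P0 would be exceptional; a lower term of index i gives N = deg T - i. *)
have [i id Ti] : exists2 i, (i < deg T)%N & T`_i != 0.
  apply: contrapT => mono; apply: nexc.
  apply: (@recenter_monomial_exceptional _ c) => // [n x n0|i iP].
    by exists (n.-root x); rewrite rootCK.
  apply: contrapT => /eqP Ti; apply: mono; exists i => //.
  by rewrite deg_recenter.
(* The coefficients at i and at deg T are both nonzero and force w^i = mu = w^(deg T). *)
have symT (w mu : R[i]) : w != 0 -> T \Po (w *: 'X) = mu *: T -> w ^+ (deg T - i) = 1.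
  move=> w0 wT; have wmu j : T`_j != 0 -> w ^+ j = mu.
    move=> Tj; apply: (mulfI Tj); rewrite -coef_comp_scaleX wT coefZ mulrC.
    by [].
  have wi0 : w ^+ i != 0 by rewrite expf_neq0.
  apply: (mulfI wi0); rewrite -exprD subnKC ?(ltnW id) // mulr1.
  by rewrite (wmu (deg T)) ?(wmu i) // coef_deg_neq0 // ltnW.
have N0 : (0 < deg T - i)%N by rewrite subn_gt0.
have tameF P : compositions F P -> tame T (recenter c P).
  apply: (@compositions_ind (fun P => tame T (recenter c P))) => [Q FQ|A B tA tB]; last first.
    by rewrite recenter_comp; exact: (tame_comp K0 sT).
  have [m [n [m0 n0 e]]] := FF _ _ FP0 FQ.
  apply: (tame_root K0 sT cT m0 n0).
  by rewrite /T -!recenter_iter e.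
have recenter_inj : injective (recenter c) := can_inj (@recenterK _ c).
pose S := generated_semigroup F.
have tameS (x : S) : tame T (recenter c (val x)) by exact/tameF/set_valP.
pose k := central_exponent T (deg T - i).
have k0 : (0 < k)%N by exact: fact_gt0.
(* After recentering, z is the iterate T^k, which commutes with all tame polynomials. *)
pose z : S := SigSub (mem_set (compositions_iter k0 FP0)).
have valM (x y : S) : val (x * y)%g = val x \Po val y by [].
apply: (amenable_of_central R (z := z)).
- move=> x; apply/val_inj/recenter_inj; rewrite !valM !recenter_comp.
  rewrite [val z]/= recenter_iter; apply/esym.
  exact: (tame_central K0 sT cT symT N0 (tameS x)).
- move=> a x y /(congr1 (fun s : S => recenter c (val s))) /=.
  rewrite !recenter_comp => axy; apply/val_inj/recenter_inj.
  exact: (tame_cancel K0 sT cT symT (tameS a) (tameS x) (tameS y) axy).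
- move=> a x y /(congr1 val); rewrite !valM => e; apply: val_inj.
  have sa : (1 < size (val a))%N.
    have [sa _ _ _] := tameS a.
    by have := deg_recenter c (val a); move: sa; rewrite /deg; lia.
  exact: (comp_poly_injl sa e).
apply: (@finite_classes_of_fibers _ z (fun x : S => degval T (recenter c (val x))) (deg T - i)).
- by move=> x y; rewrite valM recenter_comp; exact: (degval_comp sT (tameS x)).
- rewrite [val z]/= recenter_iter /degval deg_iter lognX muln_gt0 k0.
  exact: degvalT_gt0.
- move=> n f fn.
  have [i1 [j1 [ij fij]]] := tame_fiber K0 sT cT symT N0 (fun j => tameS (f j)) fn.
  by exists i1, j1; split=> //; apply/val_inj/recenter_inj.
Qed.

End GeneratedSemigroup.

Theorem theorem35 (R : realType) (F : set {poly R[i]}) :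
  nonexceptional_family F ->
  (forall P Q : {poly R[i]}, F P -> F Q -> share_iterate P Q) ->
  amenable R (generated_semigroup F) /\
  RIM R (generated_semigroup F) `<=` LIM R (generated_semigroup F).
Proof.
move=> [P0 FP0 nexc] FF.
have [sP0|sP0] := leqP (size P0) 1; first exact: amenable_constant FP0 sP0 FF.
have [sP1|sP1] := leqP (size P0) 2; last exact: amenable_nonexceptional FP0 sP1 nexc FF.
(* The remaining case is degree 1, which is exceptional by definition. *)
by case: nexc; left; apply/eqP; rewrite eqn_leq sP1.
Qed.
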